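(* Let $G$ be a finite group and $\mathcal{L}$ a lattice with oriented edges on an orientable surface, with quantum double vertex- and plaquette-operators $A(v)$, $B(p)$ on $\mathcal{H}_{\mathcal{L}}$. Let $\{e_0,\ldots,e_{k-1}\}=\mathrm{star}(v)$ be the edges incident to the vertex $v$, enumerated in clockwise order starting from $e_0$, and let $\{\tilde e_0,\ldots,\tilde e_{j-1}\}=\partial p$ be the boundary edges of the plaquette $p$ in clockwise order around $p$. Let $\mathcal{H}_{R^v}\cong\mathcal{H}_{R^p}\cong\mathbb{C}^{|G|}$ be auxiliary systems with orthonormal bases $\{|g\rangle\}_{g\in G}$, let $T^g_+=|g\rangle\langle g|_{R^v}$ and $L^g_+=\sum_z|gz\rangle\langle z|_{R^p}$, and let $$|\Psi^v\rangle_{R^v}=\frac{1}{\sqrt{|G|}}\sum_{g\in G}|g\rangle,\qquad|\Psi^p\rangle_{R^p}=|1\rangle,$$ where $1\in G$ is the identity element. Define the unitary operators $$M_i^v=M(e_i,v)=\sum_gL^g(e_i,v)\otimes(T_+^g)_{R^v},\qquad M_i^p=M(\tilde e_i,p)=\sum_gT^g(\tilde e_i,p)\otimes(L_+^g)_{R^p}$$ on $\mathcal{H}_{\mathcal{L}}\otimes\mathcal{H}_{R^v}$ and $\mathcal{H}_{\mathcal{L}}\otimes\mathcal{H}_{R^p}$, respectively, which act non-trivially only on one edge and the respective auxiliary system. Then $$A(v)=\langle\Psi^v|M_0^v\cdots M_{k-1}^v|\Psi^v\rangle=\langle\Psi^v|(M_{k-1}^v)^\dagger\cdots(M_0^v)^\dagger|\Psi^v\rangle,$$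 $$B(p)=\langle\Psi^p|M_0^p\cdots M_{j-1}^p|\Psi^p\rangle=\langle\Psi^p|(M_{j-1}^p)^\dagger\cdots(M_0^p)^\dagger|\Psi^p\rangle.$$
   Context: Quantum double model: to every oriented edge $e$ of the lattice $\mathcal{L}$ associate a space $\mathbb{C}^{|G|}$ with orthonormal basis $\{|g\rangle_e\}_{g\in G}$; $\mathcal{H}_{\mathcal{L}}$ is the tensor product over all edges. On edge $e$ define $L_+^g(e)=\sum_z|gz\rangle\langle z|_e$, $L_-^g(e)=\sum_z|zg^{-1}\rangle\langle z|_e$, $T_+^h(e)=|h\rangle\langle h|_e$, $T_-^h(e)=|h^{-1}\rangle\langle h^{-1}|_e$. If $e$ is directed from $v_-$ to $v_+$ (distinct vertices) and separates the (distinct) plaquettes $p_-$ on its left and $p_+$ on its right, put $L^g(e,v_\pm)=L^g_\pm(e)$ and $T^h(e,p_\pm)=T^h_\pm(e)$. Then $A(v)=\frac{1}{|G|}\sum_{g\in G}\prod_{e\in\mathrm{star}(v)}L^g(e,v)$, where $\mathrm{star}(v)$ is the set of edges incident to $v$, and $B(p)=\sum_{g_{r-1}\cdots g_0=1}\prod_{i=0}^{r-1}T^{g_i}(f_i,p)$, where $f_0,\ldots,f_{r-1}$ are the boundary edges of $p$ in clockwise order (the starting edge is irrelevant). For a vector $|\Psi\rangle\in\mathcal{H}_R$ and an operator $X$ on $\mathcal{H}_{\mathcal{L}}\otimes\mathcal{H}_R$, $\langle\Psi|X|\Psi\rangle$ denotes the operator $(\mathbf{1}\otimes\langle\Psi|)X(\mathbf{1}\otimes|\Psi\rangle)$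 on $\mathcal{H}_{\mathcal{L}}$.
   Formalization: For B(p) the boundary edges are enumerated counterclockwise (clockwise only if G is abelian): with clockwise order the product M_0…M_{j-1} projects onto g_0⋯g_{j-1}=1 rather than g_{j-1}⋯g_0=1, so the claim fails for non-abelian G and j≥3. *)

(* Defs.v *)
From HB Require Import structures.
From mathcomp Require Import all_boot all_order all_fingroup all_algebra.
From mathcomp Require Import reals mxtens.
From mathcomp.real_closed Require Export complex.

Set Implicit Arguments.
Unset Strict Implicit.
Unset Printing Implicit Defensive.

Import GRing.Theory Num.Theory.
Local Open Scope ring_scope.
Local Open Scope sesquilinear_scope.

(** * Lattices on oriented surfaces *)

(** A lattice on a closed oriented surface, as a combinatorial map.  An oriented
    edge [e] consists of two half-edges: [(e, false)] at its origin v_- and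
    [(e, true)] at its end v_+.  The permutation [rot] sends a half-edge to the
    next one in clockwise order around its vertex, so vertices are the orbits
    of [rot].

    Identify a half-edge with the traversal of its edge starting there.  Upon
    arrival at the other end, the next edge of the plaquette lying to the right
    of the traversal is the counterclockwise neighbour of the opposite
    half-edge.  So plaquettes are the orbits of [turn], and [turn] runs through
    the boundary of each plaquette clockwise.  Traversing [e] along its
    orientation (from [(e, false)]) has p_+ on the right; traversing it
    backwards (from [(e, true)]) has p_- on the right. *)

Definition opp_half (E : finType) (d : E * bool) : E * bool := (d.1, ~~ d.2).

Lemma opp_half_inj (E : finType) : injective (@opp_half E).
Proof. by apply: inv_inj => -[e b]; rewrite /opp_half /= negbK. Qed.

Definition face_perm (E : finType) (s : {perm E * bool}) : {perm E * bool} :=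
  (perm (@opp_half_inj E) * s^-1)%g.

Record lattice := Lattice {
  edge : finType;
  rot : {perm edge * bool};
  distinct_ends : forall e, porbit rot (e, true) != porbit rot (e, false);
  distinct_sides : forall e,
    porbit (face_perm rot) (e, true) != porbit (face_perm rot) (e, false)
}.

Section LatticeTheory.
Variable Lat : lattice.

Definition half_edge : finType := (edge Lat * bool)%type.

Definition turn : {perm half_edge} := face_perm (rot Lat).

Definition vertex := {v : {set half_edge} | v \in porbits (rot Lat)}.
Definition plaquette := {p : {set half_edge} | p \in porbits turn}.

Definition vertex_of (d : half_edge) : vertex :=
  exist _ (porbit (rot Lat) d) (imset_f (porbit (rot Lat)) (isT : d \in predT)).
Definition plaquette_of (d : half_edge) : plaquette :=
  exist _ (porbit turn d) (imset_f (porbit turn) (isT : d \in predT)).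

Definition vtx_minus (e : edge Lat) : vertex := vertex_of (e, false).
Definition vtx_plus (e : edge Lat) : vertex := vertex_of (e, true).

Definition plq_minus (e : edge Lat) : plaquette := plaquette_of (e, true).
Definition plq_plus (e : edge Lat) : plaquette := plaquette_of (e, false).

Definition star (v : vertex) : {set edge Lat} :=
  [set e | (v == vtx_minus e) || (v == vtx_plus e)].

Definition star_clockwise (v : vertex) (es : seq (edge Lat)) : Prop :=
  exists2 c : seq half_edge,
    [/\ uniq c, fcycle (rot Lat) c & c =i val v] & es = [seq d.1 | d <- c].

Definition boundary_clockwise (p : plaquette) (es : seq (edge Lat)) : Prop :=
  exists2 c : seq half_edge,
    [/\ uniq c, fcycle turn c & c =i val p] & es = [seq d.1 | d <- c].

Definition boundary_counterclockwise (p : plaquette) (es : seq (edge Lat)) :=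
  boundary_clockwise p (rev es).

(** One clockwise enumeration of the boundary of [p], from an arbitrary
    starting edge. *)
Definition boundary (p : plaquette) : seq (edge Lat) :=
  if [pick d in val p] is Some d then [seq x.1 | x <- fingraph.orbit turn d] else [::].

End LatticeTheory.

(** * The quantum double model *)

Section QuantumDouble.
Variables (C : numClosedFieldType) (gT : finGroupType) (Lat : lattice).

(** Operators on C^|G|, with orthonormal basis [ket g]. *)
Definition siteop := 'M[C]_#|gT|.

Definition ket (g : gT) : 'cV[C]_#|gT| := delta_mx (enum_rank g) 0.
Definition ketbra (g h : gT) : siteop := ket g *m (ket h)^t*.

Definition Lplus (g : gT) : siteop := \sum_z ketbra (g * z)%g z.
Definition Lminus (g : gT) : siteop := \sum_z ketbra (z * g^-1)%g z.
Definition Tplus (h : gT) : siteop := ketbra h h.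
Definition Tminus (h : gT) : siteop := ketbra h^-1%g h^-1%g.

(** The product basis of H_L, the tensor product of C^|G| over all edges,
    consists of the assignments of a group element to every edge. *)
Definition config := {ffun edge Lat -> gT}.
Definition latop := 'M[C]_#|config|.

Definition edge_tensor (K : edge Lat -> siteop) : latop :=
  \matrix_(i, j) \prod_e
    K e (enum_rank ((enum_val i : config) e)) (enum_rank ((enum_val j : config) e)).

(** [K] on the edge [e], tensored with the identity on all other edges. *)
Definition on_edge (e : edge Lat) (K : siteop) : latop :=
  edge_tensor (fun e' => if e' == e then K else 1%:M).

(** L^g(e, v) and T^h(e, p) are only meaningful for [v] an end of [e] and [p] a
    side of [e]. *)
Definition Lop (g : gT) (e : edge Lat) (v : vertex Lat) : latop :=
  on_edge e (if v == vtx_plus e then Lplus g else Lminus g).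
Definition Top (h : gT) (e : edge Lat) (p : plaquette Lat) : latop :=
  on_edge e (if p == plq_plus e then Tplus h else Tminus h).

Definition Avertex (v : vertex Lat) : latop :=
  #|gT|%:R^-1 *: \sum_(g : gT) \prod_(e in star v) Lop g e v.

Definition Bplaquette (p : plaquette Lat) : latop :=
  let f := boundary p in
  \sum_(g : (size f).-tuple gT | (\prod_(x <- rev g) x)%g == 1%g)
    \prod_(i < size f) Top (tnth g i) (tnth (in_tuple f) i) p.

(** Operators on the tensor product of H_L with an auxiliary C^|G|. *)
Definition extop := 'M[C]_(#|config| * #|gT|).

(** The partial expectation value <Psi| X |Psi>, an operator on H_L. *)
Definition partial_expect (Psi : 'cV[C]_#|gT|) (X : extop) : latop :=
  castmx (muln1 _, muln1 _) ((1%:M *t Psi^t*) *m X *m (1%:M *t Psi)).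

Definition PsiV : 'cV[C]_#|gT| := (sqrtC #|gT|%:R)^-1 *: \sum_(g : gT) ket g.
Definition PsiP : 'cV[C]_#|gT| := ket 1%g.

Definition MV (e : edge Lat) (v : vertex Lat) : extop :=
  \sum_(g : gT) Lop g e v *t Tplus g.
(** [MP] multiplies the auxiliary register on the left, so the operator product
    M_0 ... M_{j-1} maps |1> to |g_0 ... g_{j-1}>.  As [Bplaquette] projects onto
    g_{r-1} ... g_0 = 1 for a clockwise enumeration, the two agree for a
    counterclockwise enumeration, or for either one when the group is abelian. *)
Definition MP (e : edge Lat) (p : plaquette Lat) : extop :=
  \sum_(g : gT) Top g e p *t Lplus g.

(** [X] acts as some operator [K] on the edge [e] and the auxiliary system, and
    as the identity on all other edges. *)
Definition acts_only_on (e : edge Lat) (X : extop) : Prop :=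
  exists K : 'M[C]_(#|gT| * #|gT|),
    forall (x y : config) (a b : 'I_#|gT|),
      X (mxtens_index (enum_rank x, a)) (mxtens_index (enum_rank y, b)) =
      (if [forall e', (e' != e) ==> (x e' == y e')] then
         K (mxtens_index (enum_rank (x e), a)) (mxtens_index (enum_rank (y e), b))
       else 0).

End QuantumDouble.

(* Main.v *)
(** In the product basis, [M(e, v)] maps [|x>|g>] to [L^g(e, v)|x> (x) |g>], and
    [M(e, p)] maps [|x>|a>] to [|x>|h a>], where [h] is the element that
    [T^h(e, p)] reads off [x].  Hence a product of [M(e, v)]'s applies the gauge
    transformation by [g] to the star of [v], controlled by [g], and its
    expectation in [Psi^v] averages over [g]; a product of [M(e, p)]'s multiplies
    the auxiliary register by the holonomy around [p], and its expectation in
    [|1>] projects onto trivial holonomy.  That condition does not depend on the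
    starting edge, since [a b = 1] iff [b a = 1].  The versions with adjoints
    follow because [A(v)] and [B(p)] are Hermitian. *)
Require Import Defs.
From mathcomp Require Import all_boot all_order all_fingroup all_algebra.
From mathcomp Require Import reals mxtens.
From mathcomp.real_closed Require Import complex.

Set Implicit Arguments.
Unset Strict Implicit.
Unset Printing Implicit Defensive.

Import GRing.Theory Num.Theory.
Local Open Scope ring_scope.
Local Open Scope sesquilinear_scope.

Lemma prodr_bool (C : comPzSemiRingType) (I : finType) (b : pred I) :
  \prod_i (b i)%:R = [forall i, b i]%:R :> C.
Proof.
case: forallP => [bT | nb]; first by rewrite big1 // => i _; rewrite bT.
have /existsP[i /negPf bi] : [exists i, ~~ b i].
  by rewrite -negb_forall; apply/negP => /forallP.
by rewrite (bigD1 i) //= bi mul0r.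
Qed.

(** * Matrices given by maps of basis labels *)

Section BasisMaps.
Variables (C : numClosedFieldType) (T : finType) (n : nat) (enc : T -> 'I_n).
Hypothesis enc_bij : bijective enc.

(** [A] sends the basis vector labelled [y] to the one labelled [f y]. Keeping [enc] abstract serves
    both configurations and configurations paired with a register value. *)
Definition induces (f : T -> T) (A : 'M[C]_n) :=
  forall x y, A (enc x) (enc y) = (x == f y)%:R.

Lemma eq_mx_enc (A B : 'M[C]_n) :
  (forall x y, A (enc x) (enc y) = B (enc x) (enc y)) -> A = B.
Proof.
case: enc_bij => dec _ decK AB.
by apply/matrixP => i j; rewrite -(decK i) -(decK j).
Qed.

Lemma mulmx_enc (A B : 'M[C]_n) x y :
  (A *m B) (enc x) (enc y) = \sum_z A (enc x) (enc z) * B (enc z) (enc y).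
Proof. by rewrite mxE (reindex enc) //; exact: onW_bij. Qed.

Lemma scalar_enc (a : C) x y :
  a%:M (enc x) (enc y) = a * (x == y)%:R.
Proof. by rewrite mxE (inj_eq (bij_inj enc_bij)) mulr_natr. Qed.

(** The last factor of a matrix product acts first, hence [foldr]. *)
Lemma induces_prod (I : eqType) (s : seq I) (f : I -> T -> T) (A : I -> 'M[C]_n) :
    (forall a, a \in s -> induces (f a) (A a)) ->
  induces (fun x => foldr f x s) (\prod_(a <- s) A a).
Proof.
elim: s => [|a s IHs] Af x y; first by rewrite big_nil scalar_enc mul1r.
have {}IHs : induces (fun z => foldr f z s) (\prod_(b <- s) A b).
  by apply: IHs => b bs; apply: Af; rewrite inE bs orbT.
rewrite big_cons mulmx_enc (bigD1 (foldr f y s)) //= [X in _ + X]big1 => [|z /negPf zP].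
  by rewrite Af ?mem_head // IHs eqxx mulr1 addr0.
by rewrite IHs zP mulr0.
Qed.

(** Serves the operators [Top], which are projectors and so come from no map of labels. *)
Lemma diag_prod (I : Type) (s : seq I) (d : I -> T -> C) (A : I -> 'M[C]_n) :
    (forall a x y, A a (enc x) (enc y) = (x == y)%:R * d a y) ->
  forall x y, (\prod_(a <- s) A a) (enc x) (enc y) =
    (x == y)%:R * \prod_(a <- s) d a y.
Proof.
move=> Ad; elim: s => [|a s IHs] x y; first by rewrite !big_nil scalar_enc mul1r mulr1.
rewrite !big_cons mulmx_enc (bigD1 y) //= [X in _ + X]big1 => [|z /negPf zy].
  by rewrite Ad IHs eqxx mul1r addr0 mulrA.
by rewrite IHs zy mul0r mulr0.
Qed.

Lemma induces_unitary (f : T -> T) (A : 'M[C]_n) :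
  injective f -> induces f A -> A \is unitarymx.
Proof.
(* Since [A] is square, it suffices that its columns are orthonormal; injectivity of [f] makes
   distinct columns orthogonal. *)
move=> f_inj fA; apply/unitarymxP/mulmx1C/eq_mx_enc => x y.
rewrite mulmx_enc scalar_enc mul1r (bigD1 (f x)) //= [X in _ + X]big1 => [|z /negPf zx].
  by rewrite !mxE !fA eqxx (inj_eq f_inj) conjC1 mul1r addr0.
by rewrite !mxE fA zx conjC0 mul0r.
Qed.

End BasisMaps.

Lemma adj_prod (C : numClosedFieldType) n I (s : seq I) (A : I -> 'M[C]_n) :
  \prod_(a <- rev s) (A a)^t* = (\prod_(a <- s) A a)^t*.
Proof.
elim: s => [|a s IHs].
  by rewrite !big_nil trmx1 map_mx1.
by rewrite rev_cons -cats1 big_cat big_seq1 IHs big_cons trmx_mul map_mxM.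
Qed.

(** * Cyclic enumerations of stars and boundaries *)

Section Cycles.
Variable Lat : lattice.

(** Listing the orbit from any other starting half-edge only rotates the cycle. *)
Lemma plaquette_boundary (p : plaquette Lat) es :
  boundary_clockwise p es -> exists i, boundary p = rot i es.
Proof.
case: p => P PO [c [c_uniq c_cycle cP] ->]; rewrite /boundary /=.
have /imsetP[d _ Pd] := PO.
case: pickP => [d' d'P | /(_ d)]; last by rewrite /= Pd porbit_id.
have d'c : d' \in c by rewrite cP.
have [i ->] := orbit_rot_cycle c_cycle c_uniq d'c.
by exists i; rewrite map_rot.
Qed.

(** Distinct half-edges at [v] lie on distinct edges because [distinct_ends] puts the two halves of
    an edge at different vertices. *)
Lemma star_clockwise_uniq (v : vertex Lat) es :
  star_clockwise v es -> uniq es /\ es =i star v.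
Proof.
case=> c [c_uniq _ cv] ->.
have v_porbit d : (d \in val v) = (val v == porbit (Defs.rot Lat) d).
  case: v {cv} => V VO /=; have /imsetP[d0 _ ->] := VO.
  by rewrite eq_porbit_mem porbit_sym.
split.
  rewrite map_inj_in_uniq // => -[e b] [e' b']; rewrite !cv !v_porbit /=.
  move=> vb vb' ee'; move: vb vb'; rewrite -{e'}ee' => /eqP -> /eqP.
  by case: b b' => [] [] //= ends; have := @distinct_ends Lat e; rewrite ends eqxx.
have v_end d : (v == vertex_of d) = (d \in val v) by rewrite v_porbit -val_eqE.
move=> e; rewrite inE !v_end.
apply/mapP/orP => [[[e' b] /=]|].
  by rewrite cv => bv ->; case: b bv; [right | left].
by case=> ev; [exists (e, false) | exists (e, true)]; rewrite ?cv.
Qed.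

End Cycles.

(** * The local operators in the product basis *)

Section Model.
Variables (C : numClosedFieldType) (gT : finGroupType) (Lat : lattice).
Implicit Types (e : edge Lat) (v : vertex Lat) (p : plaquette Lat).
Implicit Types (x y : config gT Lat) (a b g h : gT).

Definition ext_idx (xa : config gT Lat * gT) : 'I_(#|config gT Lat| * #|gT|) :=
  mxtens_index (enum_rank xa.1, enum_rank xa.2).

Lemma ext_idx_bij : bijective ext_idx.
Proof.
exists (fun k => (enum_val (mxtens_unindex k).1, enum_val (mxtens_unindex k).2)).
  by case=> x a; rewrite /ext_idx mxtens_indexK /= !enum_rankK.
move=> k; rewrite /ext_idx -[RHS]mxtens_unindexK.
by case: (mxtens_unindex k) => i j /=; rewrite !enum_valK.
Qed.

Definition edge_upd (k : edge Lat -> gT -> gT) e x : config gT Lat :=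
  [ffun e' => if e' == e then k e (x e) else x e'].

Definition edge_act v g e z : gT :=
  if v == vtx_plus e then (g * z)%g else (z * g^-1)%g.

(* The group element that [T^h(e, p)] reads off when [e] carries [x e]. *)
Definition edge_hol p x e : gT := if p == plq_plus e then x e else (x e)^-1%g.

Lemma ketbraE g h a b :
  ketbra C g h (enum_rank a) (enum_rank b) = ((a == g) && (b == h))%:R.
Proof.
rewrite /ketbra /ket mxE big_ord1 !mxE /= !eqxx !andbT conjC_nat.
by rewrite !(inj_eq enum_rank_inj) -natrM mulnb.
Qed.

Lemma sum_ketbra (k : gT -> gT) a b :
  (\sum_z ketbra C (k z) z) (enum_rank a) (enum_rank b) = (a == k b)%:R.
Proof.
rewrite summxE (bigD1 b) //= big1 ?addr0 ?ketbraE ?eqxx ?andbT // => z.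
by rewrite eq_sym ketbraE => /negPf->; rewrite andbF.
Qed.

Lemma on_edgeE e (K : siteop C gT) x y :
  on_edge e K (enum_rank x) (enum_rank y) =
  [forall e', (e' != e) ==> (x e' == y e')]%:R *
    K (enum_rank (x e)) (enum_rank (y e)).
Proof.
rewrite mxE !enum_rankK (bigD1 e) //= eqxx mulrC; congr (_ * _).
rewrite -prodr_bool [RHS](bigD1 e) //= eqxx mul1r.
apply: eq_bigr => e' /negPf ne; rewrite ne /= scalar_enc ?mul1r //.
exact: enum_rank_bij.
Qed.

Lemma Lop_induces g e v :
  induces enum_rank (edge_upd (edge_act v g) e) (Lop C g e v).
Proof.
move=> x y; rewrite on_edgeE.
have -> : (if v == vtx_plus e then Lplus C g else Lminus C g)
    (enum_rank (x e)) (enum_rank (y e)) = (x e == edge_act v g e (y e))%:R.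
  by rewrite /edge_act; case: ifP => _; rewrite sum_ketbra.
rewrite -natrM mulnb; congr (nat_of_bool _)%:R.
apply/andP/eqP => [[/forallP xy /eqP xe] | ->].
  by apply/ffunP=> e'; rewrite ffunE; case: eqP => [->|/eqP ne] //;
    apply/eqP; exact: implyP (xy e') ne.
split; last by rewrite ffunE eqxx.
by apply/forallP => e'; apply/implyP => /negPf; rewrite ffunE => ->.
Qed.

Lemma TopE h e p x y :
  Top C h e p (enum_rank x) (enum_rank y) =
  (x == y)%:R * (h == edge_hol p y e)%:R.
Proof.
rewrite on_edgeE.
have -> : (if p == plq_plus e then Tplus C h else Tminus C h)
    (enum_rank (x e)) (enum_rank (y e)) =
    ((x e == y e) && (h == edge_hol p y e))%:R.
  rewrite /edge_hol; case: ifP => _; rewrite ketbraE; congr (nat_of_bool _)%:R.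
    by rewrite (eq_sym h); case: (y e =P h) => [->|]; rewrite ?andbF.
  rewrite -(inj_eq invg_inj) -[RHS]andbC -(inj_eq invg_inj (y e)) invgK (eq_sym h).
  by case: (_ =P h) => [<-|]; rewrite ?andbF ?andbT ?(inj_eq invg_inj).
rewrite -!natrM !mulnb andbA; congr (nat_of_bool (_ && _))%:R.
apply/andP/eqP => [[/forallP xy /eqP xe]| ->].
  by apply/ffunP=> e'; case: (eqVneq e' e) => [-> //|ne];
    apply/eqP; exact: implyP (xy e') ne.
by split=> //; apply/forallP=> e'; rewrite eqxx implybT.
Qed.

Lemma MV_induces e v :
  induces ext_idx (fun xg => (edge_upd (edge_act v xg.2) e xg.1, xg.2)) (MV C gT e v).
Proof.
(* The projector [Tplus g] keeps only the term whose [g] is the register content [b]. *)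
move=> [x a] [y b]; rewrite summxE (bigD1 b) //= big1 => [|g].
  by rewrite tensmxE Lop_induces ketbraE eqxx andbT addr0 -natrM mulnb xpair_eqE.
by rewrite eq_sym tensmxE ketbraE => /negPf->; rewrite andbF mulr0.
Qed.

Lemma MP_induces e p :
  induces ext_idx (fun xg => (xg.1, edge_hol p xg.1 e * xg.2)%g) (MP C gT e p).
Proof.
(* The operator [Top] keeps only the [g] that it reads off [y] at the edge [e]. *)
move=> [x a] [y b]; rewrite summxE (bigD1 (edge_hol p y e)) //= big1 => [|g].
  by rewrite tensmxE TopE sum_ketbra eqxx mulr1 addr0 -natrM mulnb xpair_eqE.
by rewrite tensmxE TopE => /negPf->; rewrite mulr0 mul0r.
Qed.

Lemma edge_act_inj v g e : injective (edge_act v g e).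
Proof.
by rewrite /edge_act => z z'; case: ifP => _; [apply: mulgI | apply: mulIg].
Qed.

Lemma edge_actK v g e : cancel (edge_act v g e) (edge_act v g^-1 e).
Proof.
by move=> z; rewrite /edge_act; case: (v == _); rewrite ?mulKg ?mulgK.
Qed.

Lemma MV_unitary e v : MV C gT e v \is unitarymx.
Proof.
apply: (induces_unitary ext_idx_bij _ (@MV_induces e v)) => -[x a] [y b] eq_xy.
have /= ab := congr1 snd eq_xy; have /= /ffunP xy := congr1 fst eq_xy.
(* With equal registers both configurations are moved by the same group element, whose action on the
   edge is injective. *)
rewrite -{}ab {b eq_xy} in xy *; congr (_, _).
apply/ffunP => e'; move: (xy e'); rewrite !ffunE.
by case: eqP => [->|//]; exact: edge_act_inj.
Qed.

Lemma MP_unitary e p : MP C gT e p \is unitarymx.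
Proof.
apply: (induces_unitary ext_idx_bij _ (@MP_induces e p)) => -[x a] [y b] /= [<-].
by move/mulgI->.
Qed.

Lemma induces_acts_only_on e (X : extop C gT Lat) (k : gT * gT -> gT * gT) :
    induces ext_idx
      (fun xg => (edge_upd (fun _ z => (k (z, xg.2)).1) e xg.1,
                  (k (xg.1 e, xg.2)).2)) X ->
  acts_only_on e X.
Proof.
move=> Xk; pose dec (i : 'I_(#|gT| * #|gT|)) : gT * gT :=
  (enum_val (mxtens_unindex i).1, enum_val (mxtens_unindex i).2).
(* The local operator is the matrix of [k] on pairs of an edge label and a register label. *)
exists (\matrix_(i, j) (dec i == k (dec j))%:R) => x y a b.
have -> : mxtens_index (enum_rank x, a) = ext_idx (x, enum_val a).
  by rewrite /ext_idx enum_valK.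
have -> : mxtens_index (enum_rank y, b) = ext_idx (y, enum_val b).
  by rewrite /ext_idx enum_valK.
rewrite Xk mxE /dec !mxtens_indexK /= !enum_rankK.
set kk := k _; rewrite [kk in RHS]surjective_pairing !xpair_eqE.
transitivity (([forall e', (e' != e) ==> (x e' == y e')] &&
    ((x e == kk.1) && (enum_val a == kk.2)))%:R : C); last by case: ifP.
rewrite andbA; congr (nat_of_bool (_ && _))%:R.
apply/eqP/andP => [->|[/forallP xy /eqP xe]].
  split; last by rewrite ffunE eqxx.
  by apply/forallP => e'; apply/implyP => /negPf; rewrite ffunE => ->.
by apply/ffunP=> e'; rewrite ffunE; case: eqP => [->|/eqP ne] //;
  apply/eqP; exact: implyP (xy e') ne.
Qed.

Lemma MV_acts_only_on e v : acts_only_on e (MV C gT e v).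
Proof.
apply: (@induces_acts_only_on e _ (fun zg => (edge_act v zg.2 e zg.1, zg.2))).
exact: MV_induces.
Qed.

Lemma MP_acts_only_on e p : acts_only_on e (MP C gT e p).
Proof.
apply: (@induces_acts_only_on e _ (fun zg =>
  (zg.1, (if p == plq_plus e then zg.1 else zg.1^-1) * zg.2)%g)) => xa yb.
rewrite MP_induces; congr (_ == (_, _))%:R.
by apply/ffunP => e'; rewrite ffunE; case: eqP => [->|].
Qed.

(** * Partial expectation values *)

Lemma partial_expectE (Psi : 'cV[C]_#|gT|) (X : extop C gT Lat) x y :
  partial_expect Psi X (enum_rank x) (enum_rank y) =
  \sum_a \sum_b (Psi (enum_rank a) 0)^* * X (ext_idx (x, a)) (ext_idx (y, b))
    * Psi (enum_rank b) 0.
Proof.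
(* Tensoring with a vector gives dimension [#|config| * 1]; the cast matches an index [z] with the
   pair [(z, 0)], as [z * 1 + 0 = z]. *)
have castE (z : config gT Lat) :
    cast_ord (esym (muln1 _)) (enum_rank z) = mxtens_index (enum_rank z, ord0).
  by apply: val_inj; rewrite /= muln1 addn0.
have delta (z w : config gT Lat) : 1%:M (enum_rank z) (enum_rank w) = (z == w)%:R :> C.
  by rewrite scalar_enc ?mul1r //; exact: enum_rank_bij.
have bra k : ((1%:M *t Psi^t*) *m X) (mxtens_index (enum_rank x, ord0)) k =
    \sum_a (Psi (enum_rank a) 0)^* * X (ext_idx (x, a)) k.
  rewrite mxE (reindex ext_idx) /=; last exact: onW_bij ext_idx_bij.
  rewrite -(pair_bigA _ (fun z a => (1%:M *t Psi^t*)
    (mxtens_index (enum_rank x, ord0)) (ext_idx (z, a)) * X (ext_idx (z, a)) k)) /=.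
  rewrite (bigD1 x) //= [X in _ + X]big1 => [|z /negPf zx].
    by rewrite addr0; apply: eq_bigr => a _; rewrite tensmxE delta eqxx mul1r !mxE.
  by apply: big1 => a _; rewrite tensmxE delta eq_sym zx !mul0r.
rewrite castmxE !castE mxE (reindex ext_idx) /=; last exact: onW_bij ext_idx_bij.
rewrite -(pair_bigA _ (fun z b => ((1%:M *t Psi^t*) *m X)
  (mxtens_index (enum_rank x, ord0)) (ext_idx (z, b)) * (1%:M *t Psi)
  (ext_idx (z, b)) (mxtens_index (enum_rank y, ord0)))) /=.
rewrite (bigD1 y) //= [X in _ + X]big1 => [|z /negPf zy].
  rewrite addr0 exchange_big /=; apply: eq_bigr => b _.
  by rewrite tensmxE delta eqxx mul1r bra mulr_suml.
by apply: big1 => b _; rewrite tensmxE delta zy mul0r mulr0.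
Qed.

Lemma partial_expect_adj (Psi : 'cV[C]_#|gT|) (X : extop C gT Lat) :
  partial_expect Psi (X^t*) = (partial_expect Psi X)^t*.
Proof.
apply: (eq_mx_enc (@enum_rank_bij _)) => x y.
(* The adjoint exchanges the bra and ket labels of the register, hence the two sums. *)
rewrite !mxE !partial_expectE rmorph_sum exchange_big /=.
apply: eq_bigr => a _; rewrite rmorph_sum; apply: eq_bigr => b _.
by rewrite !mxE !rmorphM /= conjCK mulrC mulrA mulrAC mulrC mulrA.
Qed.

(** * Products around a vertex or plaquette, and the vertex operator *)

Definition edges_upd (k : edge Lat -> gT -> gT) (s : seq (edge Lat)) x :
    config gT Lat :=
  [ffun e => if e \in s then k e (x e) else x e].

(** Without repetitions every edge is updated once, from its original label. The result depends only
    on the set of edges, so the order around a vertex is immaterial. *)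
Lemma foldr_edge_upd k s x : uniq s -> foldr (edge_upd k) x s = edges_upd k s x.
Proof.
elim: s => [_|e s IHs /= /andP[es /IHs ->]]; first by apply/ffunP => e; rewrite ffunE.
apply/ffunP => e'; rewrite !ffunE inE; case: (eqVneq e' e) => [->|//].
by rewrite (negPf es).
Qed.

Lemma Lop_prod g v s : uniq s ->
  induces enum_rank (edges_upd (edge_act v g) s) (\prod_(e <- s) Lop C g e v).
Proof.
move=> s_uniq x y.
rewrite (induces_prod (@enum_rank_bij _) (fun e _ => Lop_induces g e v)).
by rewrite -foldr_edge_upd.
Qed.

(** No factor changes the register, so the same group element controls all of them. *)
Lemma MV_prod v s : uniq s ->
  induces ext_idx (fun xg => (edges_upd (edge_act v xg.2) s xg.1, xg.2))
    (\prod_(e <- s) MV C gT e v).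
Proof.
move=> s_uniq xa [y b] /=.
rewrite (induces_prod ext_idx_bij (fun e _ => @MV_induces e v)).
rewrite -foldr_edge_upd //; congr (_ == _)%:R.
by elim: s {s_uniq} => //= e s ->.
Qed.

(** Each factor multiplies the register on the left and the last one acts first, so the holonomies
    appear in the order of [s]. *)
Lemma MP_prod p s :
  induces ext_idx (fun xg => (xg.1, \prod_(e <- s) edge_hol p xg.1 e * xg.2)%g)
    (\prod_(e <- s) MP C gT e p).
Proof.
move=> xa [y b] /=.
rewrite (induces_prod ext_idx_bij (fun e _ => @MP_induces e p)).
congr (_ == _)%:R; elim: s => [|e s /= ->] /=; first by rewrite big_nil mul1g.
by rewrite big_cons mulgA.
Qed.

Lemma AvertexE v s x y : uniq s -> s =i star v ->
  Avertex C gT v (enum_rank x) (enum_rank y) =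
  #|gT|%:R^-1 * \sum_g (x == edges_upd (edge_act v g) s y)%:R.
Proof.
move=> s_uniq sv; rewrite mxE summxE; congr (_ * _); apply: eq_bigr => g _.
rewrite -big_filter Lop_prod ?filter_uniq ?index_enum_uniq //.
congr (_ == _)%:R; apply/ffunP => e.
by rewrite !ffunE mem_filter mem_index_enum andbT sv.
Qed.

(** The gauge transformation by [g] is a permutation of configurations with inverse that of [g^-1],
    so the adjoint only permutes the terms of the average. *)
Lemma Avertex_adj v s : uniq s -> s =i star v ->
  (Avertex C gT v)^t* = Avertex C gT v.
Proof.
move=> s_uniq sv; apply: (eq_mx_enc (@enum_rank_bij _)) => x y.
rewrite 2!mxE !(AvertexE _ _ s_uniq sv) rmorphM fmorphV rmorph_nat /=.
rewrite rmorph_sum (reindex_inj invg_inj); congr (_ * _).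
apply: eq_bigr => g _; rewrite rmorph_nat; congr (nat_of_bool _)%:R.
have updK h z : edges_upd (edge_act v h^-1) s (edges_upd (edge_act v h) s z) = z.
  by apply/ffunP => e; rewrite !ffunE; case: (e \in s); rewrite ?edge_actK.
have updKV := updK g^-1%g; rewrite invgK in updKV.
by apply/eqP/eqP => ->; rewrite ?updKV ?updK.
Qed.

Lemma PsiV_E g : PsiV C gT (enum_rank g) 0 = (sqrtC #|gT|%:R)^-1.
Proof.
rewrite mxE summxE (bigD1 g) //= big1 ?addr0 => [|h /negPf hg].
  by rewrite mxE !eqxx mulr1.
by rewrite mxE (inj_eq enum_rank_inj) eq_sym hg.
Qed.

Lemma Avertex_expect v s : uniq s -> s =i star v ->
  Avertex C gT v = partial_expect (PsiV C gT) (\prod_(e <- s) MV C gT e v).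
Proof.
move=> s_uniq sv; apply: (eq_mx_enc (@enum_rank_bij _)) => x y.
rewrite (AvertexE _ _ s_uniq sv) partial_expectE mulr_sumr.
(* The register label is conserved, so only equal bra and ket labels contribute. *)
apply: eq_bigr => g _; rewrite (bigD1 g) //= [X in _ + X]big1 => [|h /negPf hg].
  rewrite addr0 !PsiV_E MV_prod //= xpair_eqE eqxx andbT mulrAC; congr (_ * _).
  (* The amplitude is real, and its square is the weight [#|gT|^-1] of the average. *)
  rewrite geC0_conj ?invr_ge0 ?sqrtC_ge0 ?ler0n //.
  by rewrite -invfM -expr2 sqrtCK.
by rewrite MV_prod //= xpair_eqE (eq_sym g) hg andbF mulr0 mul0r.
Qed.

(** * The plaquette operator *)

Lemma BplaquetteE p x y :
  Bplaquette C gT p (enum_rank x) (enum_rank y) =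
  ((x == y) && (\prod_(e <- rev (boundary p)) edge_hol p y e == 1)%g)%:R.
Proof.
rewrite summxE; set f := boundary p.
(* For a given [y] this is the only tuple whose term can be nonzero, so the constraint of the sum
   becomes trivial holonomy of [y]. *)
pose hol := map_tuple (edge_hol p y) (in_tuple f).
have TopsE (g : (size f).-tuple gT) :
    (\prod_(i < size f) Top C (tnth g i) (tnth (in_tuple f) i) p)
      (enum_rank x) (enum_rank y) = ((x == y) && (g == hol))%:R.
  rewrite (@diag_prod _ _ _ _ (@enum_rank_bij _) _ _ (fun i y =>
    (tnth g i == edge_hol p y (tnth (in_tuple f) i))%:R)); last first.
    by move=> i z w; exact: TopE.
  rewrite prodr_bool -natrM mulnb; congr (nat_of_bool (_ && _))%:R.
  apply/forallP/eqP => [gE|-> i]; last by rewrite tnth_map.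
  by apply: eq_from_tnth => i; rewrite (eqP (gE i)) tnth_map.
under eq_bigr do rewrite TopsE.
have <- : (\prod_(a <- rev hol) a = \prod_(e <- rev f) edge_hol p y e)%g.
  by rewrite /= -map_rev big_map.
rewrite big_mkcond (bigD1 hol) //= [X in _ + X]big1 => [|g /negPf ->].
  by rewrite addr0 eqxx andbT; case: ifP => _; rewrite ?andbT ?andbF.
by rewrite andbF if_same.
Qed.

Lemma Bplaquette_adj p : (Bplaquette C gT p)^t* = Bplaquette C gT p.
Proof.
apply: (eq_mx_enc (@enum_rank_bij _)) => x y.
rewrite 2!mxE !BplaquetteE conjC_nat.
by case: (eqVneq x y) => [->|].
Qed.

(** The register starts and ends in the label [1], so the expectation tests whether the holonomy
    along [s] is trivial. Only this condition on [s] enters, which covers both orientations of the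
    enumeration. *)
Lemma Bplaquette_expect p s :
    (forall x, (\prod_(e <- s) edge_hol p x e == 1)%g =
               (\prod_(e <- rev (boundary p)) edge_hol p x e == 1)%g) ->
  Bplaquette C gT p = partial_expect (PsiP C gT) (\prod_(e <- s) MP C gT e p).
Proof.
move=> s_hol; apply: (eq_mx_enc (@enum_rank_bij _)) => x y.
have PsiP_E g : PsiP C gT (enum_rank g) 0 = (g == 1%g)%:R.
  by rewrite mxE (inj_eq enum_rank_inj) andbT.
rewrite BplaquetteE -s_hol partial_expectE (bigD1 1%g) //= [X in _ + X]big1 => [|g /negPf g1].
  rewrite addr0 (bigD1 1%g) //= [X in _ + X]big1 => [|h /negPf h1].
    rewrite addr0 !PsiP_E eqxx conjC1 mul1r mulr1 MP_prod /= mulg1 xpair_eqE.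
    by rewrite (eq_sym 1%g).
  by rewrite !PsiP_E h1 mulr0.
by apply: big1 => h _; rewrite PsiP_E g1 conjC0 !mul0r.
Qed.

(** Rotation swaps two blocks of the product, and both orders are [1] exactly when the blocks are
    inverse to each other. *)
Lemma prod_rev_rot_eq1 (I : Type) (F : I -> gT) (s : seq I) i :
  (\prod_(e <- rev (rot i s)) F e == 1)%g = (\prod_(e <- rev s) F e == 1)%g.
Proof.
rewrite -{2}(cat_take_drop i s) /rot !rev_cat !big_cat /=.
by rewrite -eq_invg_mul eq_sym -eq_invg_mul eqg_invLR.
Qed.

Lemma prod_rev_abelian (I : Type) (F : I -> gT) (s : seq I) :
  abelian [set: gT] -> (\prod_(e <- rev s) F e = \prod_(e <- s) F e)%g.
Proof.
move=> /centsP abG; elim: s => [|e s IHs]; first by rewrite !big_nil.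
rewrite rev_cons -cats1 big_cat big_seq1 IHs big_cons.
by apply: abG; rewrite inE.
Qed.

End Model.

Theorem proposition1 (R : realType) (gT : finGroupType) (Lat : lattice) :
  (forall (v : vertex Lat) (e : seq (edge Lat)),
     star_clockwise v e ->
     [/\ (forall a, a \in e ->
            MV R[i] gT a v \is unitarymx /\ acts_only_on a (MV R[i] gT a v)),
         Avertex R[i] gT v =
           partial_expect (PsiV R[i] gT) (\prod_(a <- e) MV R[i] gT a v)
       & Avertex R[i] gT v =
           partial_expect (PsiV R[i] gT) (\prod_(a <- rev e) (MV R[i] gT a v)^t*)])
  /\
  (forall (p : plaquette Lat) (e : seq (edge Lat)),
     boundary_counterclockwise p e \/
       abelian [set: gT] /\ boundary_clockwise p e ->
     [/\ (forall a, a \in e ->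
            MP R[i] gT a p \is unitarymx /\ acts_only_on a (MP R[i] gT a p)),
         Bplaquette R[i] gT p =
           partial_expect (PsiP R[i] gT) (\prod_(a <- e) MP R[i] gT a p)
       & Bplaquette R[i] gT p =
           partial_expect (PsiP R[i] gT) (\prod_(a <- rev e) (MP R[i] gT a p)^t*)]).
Proof.
split=> [v s /star_clockwise_uniq[s_uniq sv] | p s s_bd].
  have Aexp := Avertex_expect R[i] gT s_uniq sv.
  split=> // [a _|]; first by split; [exact: MV_unitary | exact: MV_acts_only_on].
  (* The reversed product of adjoints is the adjoint of the product, so Hermiticity of the vertex
     operator concludes. *)
  rewrite adj_prod partial_expect_adj -Aexp.
  by rewrite (Avertex_adj R[i] gT s_uniq sv).
have s_hol x : (\prod_(e <- s) edge_hol (gT:=gT) p x e == 1)%g =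
    (\prod_(e <- rev (boundary p)) edge_hol p x e == 1)%g.
  (* For a counterclockwise [s], a rotation of [rev s] is the chosen boundary and the two reversals
     cancel; for a clockwise [s], commutativity absorbs the remaining reversal. *)
  case: s_bd => [/plaquette_boundary[i ->] | [abG /plaquette_boundary[i ->]]].
    by rewrite prod_rev_rot_eq1 revK.
  by rewrite prod_rev_rot_eq1 prod_rev_abelian.
have Bexp := Bplaquette_expect R[i] s_hol.
split=> // [a _|]; first by split; [exact: MP_unitary | exact: MP_acts_only_on].
by rewrite adj_prod partial_expect_adj -Bexp Bplaquette_adj.
Qed.
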